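(* Let $\mathcal{A}$ and $\mathcal{B}$ be nice GFG-tNCWs with $L(\mathcal{A})=L(\mathcal{B})$, each minimal (no GFG-tNCW for this language has fewer states) and each $\alpha$-maximal up to homogeneity. Then $\mathcal{A}$ and $\mathcal{B}$ are isomorphic.
   Context: A tNCW is $\mathcal{A}=\langle \Sigma,Q,q_0,\delta,\alpha\rangle$ with finite alphabet $\Sigma$, finite state set $Q$, initial state $q_0$, total transition function $\delta:Q\times\Sigma\to 2^Q\setminus\{\emptyset\}$ with transition relation $\Delta=\{\langle q,\sigma,s\rangle: s\in\delta(q,\sigma)\}$, and $\alpha\subseteq\Delta$ ($\alpha$-transitions; the rest are $\bar\alpha$-transitions); $\delta^{\alpha}(q,\sigma)$, $\delta^{\bar\alpha}(q,\sigma)$ denote the $\sigma$-successors of $q$ via $\alpha$- resp. $\bar\alpha$-transitions. A run on $w=\sigma_1\sigma_2\cdots$ is $r_0r_1\cdots$ with $r_0=q_0$, $r_{i+1}\in\delta(r_i,\sigma_{i+1})$, accepting iff it traverses $\alpha$-transitions only finitely often; $L(\mathcal{A})$ is the set of accepted words. $\mathcal{A}^q$ is $\mathcal{A}$ with initial state $q$. $\mathcal{A}$ is GFG if there is $f:\Sigma^*\to Q$ with $f(\epsilon)=q_0$, $\langle f(u),\sigma,f(u\sigma)\rangle\in\Delta$ for all $u,\sigma$, and for every $w\in L(\mathcal{A})$ the run $f(w[1,0]),f(w[1,1]),\dots$ is accepting; a state $q$ is GFG if $\mathcal{A}^q$ is. $q\sim s$ iff $L(\mathcal{A}^q)=L(\mathcal{A}^s)$.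 $\mathcal{A}$ is semantically deterministic if any two $\sigma$-successors of any state are $\sim$-equivalent; safe deterministic if $|\delta^{\bar\alpha}(q,\sigma)|\le1$ always; normal if a path of $\bar\alpha$-transitions from $q$ to $s$ implies one from $s$ to $q$. A GFG-tNCW is nice if all states are reachable and GFG and it is normal, safe deterministic and semantically deterministic. $\mathcal{A}$ is $\alpha$-homogenous if for all $q,\sigma$, $\delta^\alpha(q,\sigma)=\emptyset$ or $\delta^{\bar\alpha}(q,\sigma)=\emptyset$. A triple $\langle q,\sigma,s\rangle\in Q\times\Sigma\times Q$ is an allowed transition if there is $s'\in Q$ with $s\sim s'$ and $\langle q,\sigma,s'\rangle\in\Delta$. $\mathcal{A}$ is $\alpha$-maximal up to homogeneity if it is $\alpha$-homogenous and for every $q\in Q$ and $\sigma\in\Sigma$ with $\delta^{\bar\alpha}(q,\sigma)=\emptyset$, every allowed transition in $\{q\}\times\{\sigma\}\times Q$ is in $\Delta$. Tnc Ws $\mathcal{A},\mathcal{B}$ with state sets $Q_\mathcal{A},Q_\mathcal{B}$ are isomorphic if there is a bijection $\kappa:Q_\mathcal{A}\to Q_\mathcal{B}$ such that for all $q,q'\in Q_\mathcal{A}$, $\sigma\in\Sigma$: $q'\in\delta^{\alpha}_\mathcal{A}(q,\sigma)$ iff $\kappa(q')\in\delta^{\alpha}_\mathcal{B}(\kappa(q),\sigma)$, and $q'\in\delta^{\bar\alpha}_\mathcal{A}(q,\sigma)$ iff $\kappa(q')\in\delta^{\bar\alpha}_\mathcal{B}(\kappa(q),\sigma)$. *)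

(* Defs.v *)
From mathcomp Require Import all_boot.

Set Implicit Arguments.
Unset Strict Implicit.
Unset Printing Implicit Defensive.

Definition trans_rel (Sigma Q : finType) (delta : Q -> Sigma -> {set Q}) :
    {set Q * Sigma * Q} :=
  [set t | t.2 \in delta t.1.1 t.1.2].

Record tNCW (Sigma : finType) := TNCW {
  state : finType;
  init : state;
  delta : state -> Sigma -> {set state};
  alpha : {set state * Sigma * state};
  delta_total : forall q a, delta q a != set0;
  alpha_sub : alpha \subset trans_rel delta
}.

Arguments init {Sigma} _.
Arguments delta {Sigma} _ _ _.
Arguments alpha {Sigma} _.

Definition word (Sigma : finType) := nat -> Sigma.

Section Automata.

Variable Sigma : finType.
Implicit Types (A B C : tNCW Sigma) (w : word Sigma).

Definition Delta A : {set state A * Sigma * state A} := trans_rel (delta A).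

Definition delta_alpha A (q : state A) (a : Sigma) : {set state A} :=
  [set s | (q, a, s) \in alpha A].

Definition delta_safe A (q : state A) (a : Sigma) : {set state A} :=
  [set s in delta A q a | (q, a, s) \notin alpha A].

Definition with_init A (q : state A) : tNCW Sigma :=
  @TNCW Sigma (state A) q (delta A) (alpha A)
    (@delta_total _ A) (@alpha_sub _ A).

(* Letters are numbered from 0: [w i] is the letter sigma_(i+1), read between
   [r i] and [r i.+1]. *)
Definition is_run A w (r : nat -> state A) : Prop :=
  r 0 = init A /\ forall i, r i.+1 \in delta A (r i) (w i).

Definition accepting A w (r : nat -> state A) : Prop :=
  exists N, forall i, N <= i -> (r i, w i, r i.+1) \notin alpha A.

Definition lang A w : Prop :=
  exists r : nat -> state A, is_run w r /\ accepting w r.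

Definition same_lang A B : Prop := forall w, lang A w <-> lang B w.

(* [mkseq w i] is the prefix of length [i] of [w]. *)
Definition GFG A : Prop :=
  exists f : seq Sigma -> state A,
    [/\ f [::] = init A,
        forall u a, (f u, a, f (rcons u a)) \in Delta A
      & forall w, lang A w -> accepting w (fun i => f (mkseq w i))].

Definition GFG_state A (q : state A) : Prop := GFG (with_init q).

Definition state_equiv A (q s : state A) : Prop :=
  same_lang (with_init q) (with_init s).

Definition reachable A (q : state A) : bool :=
  connect (fun p s => [exists a, s \in delta A p a]) (init A) q.

Definition semantically_deterministic A : Prop :=
  forall (q : state A) a s s',
    s \in delta A q a -> s' \in delta A q a -> state_equiv s s'.

Definition safe_deterministic A : Prop :=
  forall (q : state A) a, #|delta_safe q a| <= 1.

Definition safe_path A : rel (state A) :=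
  connect (fun p s => [exists a, s \in delta_safe p a]).

Definition normal A : Prop :=
  forall q s : state A, safe_path q s -> safe_path s q.

Definition nice A : Prop :=
  GFG A /\
  [/\ forall q : state A, reachable q,
      forall q : state A, GFG_state q,
      normal A,
      safe_deterministic A
    & semantically_deterministic A].

Definition minimal A : Prop :=
  forall C, GFG C -> same_lang C A -> #|state A| <= #|state C|.

Definition alpha_homogenous A : Prop :=
  forall (q : state A) a, delta_alpha q a = set0 \/ delta_safe q a = set0.

Definition allowed A (q : state A) (a : Sigma) (s : state A) : Prop :=
  exists s', state_equiv s s' /\ (q, a, s') \in Delta A.

Definition alpha_maximal_up_to_homogeneity A : Prop :=
  alpha_homogenous A /\
  forall (q : state A) a, delta_safe q a = set0 ->
    forall s, allowed q a s -> (q, a, s) \in Delta A.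

Definition isomorphic A B : Prop :=
  exists kappa : state A -> state B,
    bijective kappa /\
    forall (q q' : state A) a,
      (q' \in delta_alpha q a <-> kappa q' \in delta_alpha (kappa q) a) /\
      (q' \in delta_safe q a <-> kappa q' \in delta_safe (kappa q) a).

End Automata.

(* Main.v *)
(* Order states, across both automata, by equality of languages together with
   inclusion of safe languages. Every state of A lies below some state of B: if
   not, normality lets one loop forever on words that are safe in A and force
   an alpha-transition of the GFG strategy of B. In a minimal nice automaton,
   states that are equivalent in this preorder are equal, and comparable states
   share a safe component, because otherwise restricting to a proper subset of
   the states would give a smaller GFG automaton. Hence each state of A has a
   unique equivalent state in B. Safe transitions are preserved by this
   correspondence since safe successors of equivalent states are equivalent,
   and alpha-transitions since they are saturated wherever no safe transition
   exists. *)
Require Import Defs.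
From mathcomp Require Import all_boot.
From mathcomp Require Import boolp.

Set Implicit Arguments.
Unset Strict Implicit.
Unset Printing Implicit Defensive.

(** * Infinite words as limits of prefixes *)

Section Words.

Variable T : Type.

Definition wcons (a : T) (w : nat -> T) : nat -> T :=
  fun i => if i is j.+1 then w j else a.

Definition wdrop N (w : nat -> T) : nat -> T := fun i => w (N + i).

Lemma mkseq_wdrop N (w : nat -> T) n :
  mkseq w (N + n) = mkseq w N ++ mkseq (wdrop N w) n.
Proof.
by rewrite /mkseq iotaD map_cat add0n -[in iota N n](addn0 N) iotaDl -map_comp.
Qed.

End Words.

Lemma limit_word (T : eqType) (X : nat -> seq T) :
  (forall n, prefix (X n) (X n.+1)) -> (forall n, n <= size (X n)) ->
  exists w, forall n, mkseq w (size (X n)) = X n.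
Proof.
move=> Xpre Xsz.
have d : T by case: (X 1) (Xsz 1) => [|d l _].
have Xadd m k : prefix (X m) (X (m + k)).
  elim: k => [|k IH]; first by rewrite addn0 prefix_refl.
  by rewrite addnS; apply: prefix_trans IH (Xpre _).
have Xmono m n : m <= n -> prefix (X m) (X n) by move=> le_mn; rewrite -(subnKC le_mn).
(* [X i.+1] is the first term guaranteed to have a letter at position [i]; the default [d] is never
   read. *)
exists (fun i => nth d (X i.+1) i) => n.
apply: (@eq_from_nth _ d) => [|i]; rewrite size_mkseq // => lt_i.
rewrite nth_mkseq //.
have lt_i' : i < size (X i.+1) by apply: Xsz.
case/orP: (leq_total i.+1 n) => /Xmono /prefixP[z E]; rewrite E nth_cat.
- by rewrite lt_i'.
- by rewrite lt_i.
Qed.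

(** * Safe runs and languages along transitions *)

Section SafeRuns.

Variable Sigma : finType.
Implicit Types (A B C : tNCW Sigma) (w : word Sigma) (u v : seq Sigma).

Local Notation L q := (lang (with_init q)).

Lemma langE A (q : state A) w :
  L q w <-> exists r : nat -> state A,
    [/\ r 0 = q, forall i, r i.+1 \in delta A (r i) (w i)
      & accepting w r].
Proof.
by split=> [[r [[r0 rS] acc]]|[r [r0 rS acc]]]; exists r.
Qed.

(** Under safe determinism the pick is the unique safe successor, so safe moves form a partial
    function. *)
Definition sstep A (q : state A) a : option (state A) :=
  [pick s in delta_safe q a].

(** Coerced to [bool] and under safe determinism, it tests whether [u] can be read from [q] without
    alpha-transitions. *)
Fixpoint srun A (q : state A) u : option (state A) :=
  if u is a :: u' then obind (fun p => srun p u') (sstep q a) else Some q.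

Lemma sstep_safe A (q s : state A) a : sstep q a = Some s -> s \in delta_safe q a.
Proof. by rewrite /sstep; case: pickP => // x ? [<-]. Qed.

Lemma sstep_delta A (q s : state A) a : sstep q a = Some s -> s \in delta A q a.
Proof. by move/sstep_safe; rewrite inE => /andP[]. Qed.

Lemma sstepP A (q s : state A) a :
  safe_deterministic A -> (s \in delta_safe q a) = (sstep q a == Some s).
Proof.
move=> sdA; apply/idP/eqP => [sq|/sstep_safe //].
rewrite /sstep; case: pickP => [x xq|/(_ s)]; last by rewrite sq.
by congr Some; apply: (card_le1_eqP (sdA q a)).
Qed.

Lemma sstep_notin_alpha A (q s : state A) a : safe_deterministic A ->
  (q, a, s) \notin alpha A -> s \in delta A q a -> sstep q a = Some s.
Proof. by move=> sdA qs qd; apply/eqP; rewrite -sstepP // inE qd. Qed.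

Lemma sstep_None A (q : state A) a : sstep q a = None <-> delta_safe q a = set0.
Proof.
rewrite /sstep; case: pickP => [x xq|q0]; split=> //.
- by move=> E; rewrite E inE in xq.
- by move=> _; apply/setP=> x; rewrite q0 inE.
Qed.

Lemma srun_cat A (q : state A) u v :
  srun q (u ++ v) = obind (fun p => srun p v) (srun q u).
Proof. by elim: u q => //= a u IH q; case: (sstep q a). Qed.

Lemma srun_rcons A (q : state A) u a :
  srun q (rcons u a) = obind (fun p => sstep p a) (srun q u).
Proof.
rewrite -cats1 srun_cat; case: (srun q u) => //= p.
by case: (sstep p a).
Qed.

Lemma safe_pathP A (q s : state A) : safe_deterministic A ->
  safe_path q s <-> exists u, srun q u = Some s.
Proof.
move=> sdA; split=> [/connectP[p + ->]|[u]].
  elim: p q => [|x p IH] q /=; first by exists [::].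
  case/andP=> /existsP[a]; rewrite sstepP // => /eqP qx /IH[u xu].
  by exists (a :: u); rewrite /= qx.
elim: u q => [|a u IH] q /=; first by case=> ->; apply: connect0.
case qx: (sstep q a) => [x|] //= /IH; apply: connect_trans.
by apply: connect1; apply/existsP; exists a; apply: sstep_safe.
Qed.

Lemma safe_word_lang A (q : state A) w :
  (forall n, srun q (mkseq w n)) -> L q w.
Proof.
move=> safe_w; apply/langE.
exists (fun n => odflt q (srun q (mkseq w n))).
have safe_i i : odflt q (srun q (mkseq w i.+1)) \in
    delta_safe (odflt q (srun q (mkseq w i))) (w i).
  move: (safe_w i) (safe_w i.+1); rewrite mkseqS srun_rcons.
  case: (srun q (mkseq w i)) => //= p _.
  by case E: (sstep p (w i)) => [s|] //= _; apply: sstep_safe.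
split=> // [i|]; last exists 0 => i _; by have:= safe_i i; rewrite inE => /andP[].
Qed.

Lemma safe_run_srun B (r : nat -> state B) w N n :
  safe_deterministic B ->
  (forall i, r i.+1 \in delta B (r i) (w i)) ->
  (forall i, N <= i -> (r i, w i, r i.+1) \notin alpha B) ->
  srun (r N) (mkseq (wdrop N w) n) = Some (r (N + n)).
Proof.
move=> sdB rS rsafe; elim: n => [|n IH]; first by rewrite addn0.
rewrite mkseqS srun_rcons IH /= addnS; apply/eqP.
by rewrite -sstepP // inE rS rsafe ?leq_addr.
Qed.

(** Acceptance ignores the first transition; a run through another successor is exchanged for one
    from [q'] by semantic determinism. *)
Lemma lang_step A (q q' : state A) w : semantically_deterministic A ->
  q' \in delta A q (w 0) -> L q w <-> L q' (wdrop 1 w).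
Proof.
move=> sdA qq'; split=> /langE[r [r0 rS [N acc]]].
  have r1 : r 1 \in delta A q (w 0) by rewrite -r0.
  apply/(sdA _ _ _ _ r1 qq')/langE; exists (fun i => r i.+1); split=> //.
  by exists N => i leNi; apply: acc; apply: leqW.
apply/langE; exists (wcons q r); split=> //.
  by case=> [|i] //=; rewrite r0.
by exists N.+1 => [[|i]] //; apply: acc.
Qed.

Lemma equiv_step A B (q q' : state A) (s s' : state B) a :
  semantically_deterministic A -> semantically_deterministic B ->
  same_lang (with_init q) (with_init s) ->
  q' \in delta A q a -> s' \in delta B s a ->
  same_lang (with_init q') (with_init s').
Proof.
move=> sdA sdB qs qq' ss' w.
have hq := @lang_step A q q' (wcons a w) sdA qq'.
have hs := @lang_step B s s' (wcons a w) sdB ss'.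
exact: iff_trans (iff_sym hq) (iff_trans (qs _) hs).
Qed.

(** * The preorder on states across automata *)

Lemma same_lang_sym A B : same_lang A B -> same_lang B A.
Proof. by move=> AB w; apply: iff_sym. Qed.

Lemma same_lang_trans B A C : same_lang A B -> same_lang B C -> same_lang A C.
Proof. by move=> AB BC w; apply: iff_trans (AB w) (BC w). Qed.

(* Finite safe words are used in place of infinite ones: by normality and safe
   determinism the two inclusions of safe languages agree. *)
Definition safe_le A B (q : state A) (s : state B) : Prop :=
  same_lang (with_init q) (with_init s) /\ forall u, srun q u -> srun s u.

Definition safe_eqv A B (q : state A) (s : state B) : Prop :=
  safe_le q s /\ safe_le s q.

Lemma safe_le_trans A B C (s : state B) (q : state A) (t : state C) :
  safe_le q s -> safe_le s t -> safe_le q t.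
Proof.
move=> [qs qsu] [st stu]; split=> [|u /qsu /stu //].
exact: same_lang_trans qs st.
Qed.

Lemma safe_eqv_sym A B (q : state A) (s : state B) :
  safe_eqv q s -> safe_eqv s q.
Proof. by case. Qed.

Lemma safe_eqv_trans A B C (s : state B) (q : state A) (t : state C) :
  safe_eqv q s -> safe_eqv s t -> safe_eqv q t.
Proof. by move=> [? ?] [? ?]; split; apply: (@safe_le_trans _ _ _ s). Qed.

Section Steps.

Variables (A B : tNCW Sigma).
Hypotheses (detA : semantically_deterministic A)
           (detB : semantically_deterministic B).

Lemma safe_le_step (q q' : state A) (s : state B) a :
  safe_le q s -> sstep q a = Some q' ->
  exists2 s', sstep s a = Some s' & safe_le q' s'.
Proof.
move=> [qs qsu] qq'; have := qsu [:: a]; rewrite /= qq' => /(_ isT).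
case ss': (sstep s a) => [s'|] //= _; exists s' => //; split=> [|u].
  exact: (equiv_step detA detB qs (sstep_delta qq') (sstep_delta ss')).
by have := qsu (a :: u); rewrite /= qq' ss'.
Qed.

Lemma safe_le_run (q q' : state A) (s : state B) u :
  safe_le q s -> srun q u = Some q' ->
  exists2 s', srun s u = Some s' & safe_le q' s'.
Proof.
elim: u q s => [|a u IH] q s qs /=; first by case=> <-; exists s.
case qx: (sstep q a) => [x|] //= xq'.
by have [y -> xy] := safe_le_step qs qx; apply: IH xq'.
Qed.

End Steps.

Lemma safe_eqv_run A B (q q' : state A) (s : state B) u :
  semantically_deterministic A -> semantically_deterministic B ->
  safe_eqv q s -> srun q u = Some q' ->
  exists2 s', srun s u = Some s' & safe_eqv q' s'.
Proof.
move=> detA detB [qs sq] qq'; have [s' ss' le1] := safe_le_run detA detB qs qq'.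
(* Since [srun] is a function, reading [u] from [q] again ends in [q'], so this comparison is the
   missing reverse one. *)
have [q'' + le2] := safe_le_run detB detA sq ss'.
by rewrite qq' => -[E]; exists s' => //; split=> //; rewrite E.
Qed.

Lemma safe_eqv_step A B (q q' : state A) (s : state B) a :
  semantically_deterministic A -> semantically_deterministic B ->
  safe_eqv q s -> sstep q a = Some q' ->
  exists2 s', sstep s a = Some s' & safe_eqv q' s'.
Proof.
move=> detA detB qs qq'.
have [|s' + q's'] := @safe_eqv_run A B q q' s [:: a] detA detB qs.
  by rewrite /= qq'.
by rewrite /=; case: (sstep s a) => //= x [->]; exists s'.
Qed.

(** * Domination by a state of the other automaton *)

Lemma equiv_strategy A B (g : seq Sigma -> state B) (q q' : state A) x u :
  semantically_deterministic A -> semantically_deterministic B ->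
  (forall y a, g (rcons y a) \in delta B (g y) a) ->
  same_lang (with_init q) (with_init (g x)) -> srun q u = Some q' ->
  same_lang (with_init q') (with_init (g (x ++ u))).
Proof.
move=> detA detB gS; elim: u q x => [|a u IH] q x /= qx.
  by case=> <-; rewrite cats0.
case qp: (sstep q a) => [p|] //= pq'; rewrite -cat_rcons; apply: IH pq'.
exact: (equiv_step detA detB qx (sstep_delta qp) (gS x a)).
Qed.

(* Otherwise each s ~ q has a finite word that is safe from q, not safe from s,
   and (by normality) leads q back to itself; feeding the strategy of B such
   words forever makes it reject a word accepted from q. *)
Lemma safe_le_exists A B (q : state A) (s0 : state B) :
  normal A -> safe_deterministic A -> semantically_deterministic A ->
  safe_deterministic B -> semantically_deterministic B ->
  GFG_state s0 -> same_lang (with_init q) (with_init s0) ->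
  exists s : state B, safe_le q s.
Proof.
move=> normA sdA detA sdB detB [f [f0 fS facc]] qs0; apply: contrapT => no_s.
have loops (s : state B) : exists u, same_lang (with_init q) (with_init s) ->
    srun q u = Some q /\ srun s u = None.
  case: (pselect (same_lang (with_init q) (with_init s))) => [qs|]; last first.
    by exists [::].
  have [u [qu su]] : exists u, srun q u /\ ~ srun s u.
    apply: contrapT => no_u; apply: no_s; exists s; split=> // u qu.
    by apply: contrapT => su; apply: no_u; exists u.
  case qp: (srun q u) qu => [p|] // _.
  have /normA/(safe_pathP _ _ sdA)[v pv] : safe_path q p.
    by apply/safe_pathP => //; exists u.
  exists (u ++ v) => _; rewrite !srun_cat qp; split=> //.
  by case: (srun s u) su => [?|] //= [].
have [U UP] := fin_all_exists loops.
pose g : seq Sigma -> state B := f.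
have gS y a : g (rcons y a) \in delta B (g y) a.
  by have := fS y a; rewrite inE.
pose X n := iter n (fun x => x ++ U (g x)) [::].
have XP n : srun q (X n) = Some q /\ same_lang (with_init q) (with_init (g (X n))).
  elim: n => [|n [IHr IHl]]; first by rewrite /= /g f0.
  have [qU _] := UP _ IHl; split; first by rewrite /= srun_cat IHr.
  exact: equiv_strategy qU.
(* The chosen words are nonempty because the empty word is safe from every state. *)
have X_size n : n <= size (X n).
  elim: n => // n IH; rewrite /= size_cat.
  have [_] := UP _ (XP n).2; case: (U _) => [|a u] //= _.
  by rewrite addnS ltnS (leq_trans IH) ?leq_addr.
have [||w wX] := @limit_word _ X; [|done|].
  by move=> n; apply: prefix_prefix.
have Lqw : L q w.
  apply: safe_word_lang => n; have [+ _] := XP n.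
  rewrite -wX -(subnKC (X_size n)) mkseq_wdrop srun_cat.
  by case: (srun q _).
have [N Nacc] := facc w (proj1 (qs0 w) Lqw).
have [_ sN] := UP _ (XP N).2.
have rS i : g (mkseq w i.+1) \in delta B (g (mkseq w i)) (w i).
  by rewrite mkseqS.
have racc i : size (X N) <= i ->
    (g (mkseq w i), w i, g (mkseq w i.+1)) \notin alpha B.
  by move=> le_i; apply: Nacc; apply: leq_trans le_i.
(* [X N] has length at least [N], so beyond it the strategy stays safe, yet the next block is unsafe
   from the state reached. *)
have := @safe_run_srun B (fun i => g (mkseq w i)) w _ (size (U (g (X N)))) sdB rS racc.
have -> : mkseq (wdrop (size (X N)) w) (size (U (g (X N)))) = U (g (X N)).
  have := wX N.+1; rewrite /= size_cat mkseq_wdrop => /eqP.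
  by rewrite eqseq_cat ?size_mkseq // => /andP[_ /eqP].
by rewrite wX sN.
Qed.

(** * Restriction to a dominating set of states *)

Section Restriction.

Variables (A : tNCW Sigma) (P : {set state A}).
Hypotheses (gfgA : GFG A) (sdA : safe_deterministic A)
           (detA : semantically_deterministic A).
Hypothesis P_dominates : forall q : state A, exists2 q', q' \in P & safe_le q q'.
Hypothesis P_safe_closed : forall q a r, q \in P -> sstep q a = Some r ->
  exists2 r', r' \in P & safe_eqv r r'.

Local Notation Q := {x : state A | x \in P}.

(** Closing under language equivalence allows jumps to dominating states in [P]. *)
Definition restr_delta (q : Q) a : {set Q} :=
  [set s | `[< exists2 p, p \in delta A (val q) a
                        & same_lang (with_init p) (with_init (val s)) >]].

(** The safe successor may lie outside [P]; an equivalent state of [P] stands in for it. *)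
Definition restr_safe (q : Q) a (s : Q) : bool :=
  `[< exists2 r, sstep (val q) a = Some r & safe_eqv r (val s) >].

Definition restr_alpha : {set Q * Sigma * Q} :=
  [set t in trans_rel restr_delta | ~~ restr_safe t.1.1 t.1.2 t.2].

Lemma restr_delta_total q a : restr_delta q a != set0.
Proof.
have /set0Pn[p pq] := delta_total (val q) a.
have [s sP [ps _]] := P_dominates p.
by apply/set0Pn; exists (Sub s sP); rewrite inE; apply/asboolP; exists p.
Qed.

Lemma restr_alpha_sub : restr_alpha \subset trans_rel restr_delta.
Proof. by apply/subsetP => t; rewrite inE => /andP[]. Qed.

Definition restr (q0 : Q) : tNCW Sigma :=
  TNCW q0 restr_delta_total restr_alpha_sub.

Lemma restr_run_lang (r : nat -> Q) w n :
  (forall i, r i.+1 \in restr_delta (r i) (w i)) ->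
  L (val (r n)) (wdrop n w) -> L (val (r 0)) w.
Proof.
elim: n r w => [//|n IH] r w rS Lrn.
have := rS 0; rewrite inE => /asboolP[p p_r0 p_r1].
apply/(lang_step detA p_r0)/p_r1.
by apply: (IH (fun i => r i.+1)) => // i; apply: (rS i.+1).
Qed.

Lemma restr_lang_sub q0 w :
  safe_le (init A) (val q0) -> lang (restr q0) w -> lang A w.
Proof.
move=> [Aq0 _] [r [[r0 rS] [N acc]]].
apply/(Aq0 w); rewrite -[q0]r0; apply: (restr_run_lang (n := N)) => //.
apply: safe_word_lang => n.
(* The restricted run need not be a run of [A]; a genuine safe run shadows it up to [safe_eqv]. *)
suff [p -> _] : exists2 p, srun (val (r N)) (mkseq (wdrop N w) n) = Some p
    & safe_eqv p (val (r (N + n))) by [].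
elim: n => [|n [p IH p_r]]; first by rewrite addn0; exists (val (r N)).
rewrite mkseqS srun_rcons IH /= addnS.
have := acc (N + n) (leq_addr _ _).
rewrite inE negb_and negbK [_ \in trans_rel _]inE (rS (N + n)) /=.
case/asboolP => x rx x_r.
have [y py xy] := safe_eqv_step detA detA (safe_eqv_sym p_r) rx.
by exists y => //; apply: safe_eqv_trans (safe_eqv_sym xy) x_r.
Qed.

(* The strategy mimics safe transitions, and on an alpha-transition jumps to a
   state dominating the current state of a strategy of A. Once the latter is
   safe forever, at most one more jump occurs. *)
Lemma restr_strategy q0 : safe_le (init A) (val q0) ->
  exists g : seq Sigma -> state (restr q0),
    [/\ g [::] = q0,
        forall u a, (g u, a, g (rcons u a)) \in Delta (restr q0)
      & forall w, lang A w -> accepting w (fun i => g (mkseq w i))].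
Proof.
move=> Aq0; have [f [f0 fS facc]] := gfgA.
have fS' u a : f (rcons u a) \in delta A (f u) a by have := fS u a; rewrite inE.
have /fin_all_exists[up upP] (q : state A) : exists s : Q, safe_le q (val s).
  by have [s sP qs] := P_dominates q; exists (Sub s sP).
have /fin_all_exists[nx nxP] (qa : Q * Sigma) : exists s : Q,
    forall r, sstep (val qa.1) qa.2 = Some r -> safe_eqv r (val s).
  case E: (sstep (val qa.1) qa.2) => [r|]; last by exists q0.
  have [s sP rs] := P_safe_closed (valP qa.1) E.
  by exists (Sub s sP) => _ [<-].
(* The first component stores the word read so far, needed to query [f] at a jump. *)
pose step (c : seq Sigma * Q) a := (rcons c.1 a,
  if sstep (val c.2) a is Some _ then nx (c.2, a) else up (f (rcons c.1 a))).
pose g u : Q := (foldl step ([::], q0) u).2.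
have g1 u : (foldl step ([::], q0) u).1 = u.
  elim/last_ind: u => // u a IH.
  by rewrite -[in LHS]cats1 foldl_cat /= IH.
have gS u a : g (rcons u a) =
    if sstep (val (g u)) a is Some _ then nx (g u, a) else up (f (rcons u a)).
  by rewrite /g -[in LHS]cats1 foldl_cat /= g1.
have fg u : same_lang (with_init (f u)) (with_init (val (g u))).
  elim/last_ind: u => [|u a IH]; first by rewrite f0; case: Aq0.
  rewrite gS; case E: (sstep (val (g u)) a) => [r|]; last by case: (upP (f (rcons u a))).
  apply: same_lang_trans (proj1 (proj1 (nxP (g u, a) r E))).
  exact: (equiv_step detA detA IH (fS' u a) (sstep_delta E)).
have gD u a : g (rcons u a) \in restr_delta (g u) a.
  have /set0Pn[p pg] := delta_total (val (g u)) a.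
  rewrite inE; apply/asboolP; exists p => //.
  apply: same_lang_trans (fg (rcons u a)).
  exact: (equiv_step detA detA (same_lang_sym (fg u)) pg (fS' u a)).
have galpha u a : (g u, a, g (rcons u a)) \notin restr_alpha ->
    exists2 r, sstep (val (g u)) a = Some r & safe_eqv r (val (g (rcons u a))).
  by rewrite inE negb_and negbK [_ \in trans_rel _]inE gD /= => /asboolP.
have gjump u a : (g u, a, g (rcons u a)) \in restr_alpha ->
    safe_le (f (rcons u a)) (val (g (rcons u a))).
  rewrite inE => /andP[_]; rewrite /restr_safe /= => /asboolP.
  rewrite gS; case E: (sstep (val (g u)) a) => [r|] // []; exists r => //.
  exact: (nxP (g u, a)).
exists g; split=> // [u a|w Lw]; first by rewrite inE; apply: gD.
have [N acc] := facc w Lw.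
pose good i := safe_le (f (mkseq w i)) (val (g (mkseq w i))).
have goodS i : N <= i -> good i ->
    good i.+1 /\ (g (mkseq w i), w i, g (mkseq w i.+1)) \notin restr_alpha.
  move=> leNi gi; have /(sstep_notin_alpha sdA) fi := acc i leNi.
  rewrite /good mkseqS in fi *.
  have [r E fr] := safe_le_step detA detA gi (fi (fS' _ _)).
  have [rg gr] := nxP (g (mkseq w i), w i) r E.
  have gE : g (rcons (mkseq w i) (w i)) = nx (g (mkseq w i), w i) by rewrite gS E.
  split; first by rewrite gE; apply: safe_le_trans fr rg.
  rewrite inE negb_and negbK; apply/orP; right.
  by apply/asboolP; exists r; rewrite //= gE.
(* Goodness persists once reached after [N]; if it is never reached, no alpha-transition occurs
   there, since a jump makes the next position good. *)
case: (pselect (exists2 i, N <= i & good i)) => [[i leNi gi]|no_good].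
  have goodD k : good (i + k).
    elim: k => [|k IH]; first by rewrite addn0.
    by rewrite addnS; apply: (goodS _ _ IH).1; apply: leq_trans leNi (leq_addr _ _).
  exists i => j leij; have := goodD (j - i); rewrite subnKC // => gj.
  by apply: (goodS _ _ gj).2; apply: leq_trans leNi leij.
exists N => i leNi; apply/negP; rewrite mkseqS => /gjump gi.
by apply: no_good; exists i.+1; [apply: leqW | rewrite /good mkseqS].
Qed.

(** The restriction is a GFG automaton for the same language with [#|P|] states. *)
Lemma minimal_restr : minimal A -> P = setT.
Proof.
move=> minA; have [q0 q0P Aq0'] := P_dominates (init A).
pose z : Q := Sub q0 q0P; have Aq0 : safe_le (init A) (val z) by [].
have [g [g0 gS gacc]] := restr_strategy Aq0.
have CA : same_lang (restr z) A.
  move=> w; split=> [|Lw]; first exact: restr_lang_sub.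
  exists (fun i => g (mkseq w i)); split; last exact: gacc.
  by split=> // i; rewrite mkseqS; have := gS (mkseq w i) (w i); rewrite inE.
have gfgC : GFG (restr z).
  by exists g; split=> // w /CA; apply: gacc.
have := minA _ gfgC CA; rewrite /= card_sig => leP.
by apply/eqP; rewrite eqEcard subsetT cardsT.
Qed.

End Restriction.

(** * Consequences of minimality *)

Lemma minimal_centralized A (q s : state A) :
  nice A -> minimal A -> safe_le q s -> safe_path s q.
Proof.
move=> [gfgA [_ _ normA sdA detA]] minA qs; apply: contrapT => nsq.
(* Delete the safe component of [q]: normality forbids entering it safely from outside, and a state
   reached from [q] by [u] is dominated by the one reached from [s] by [u], which lies outside. *)
suff /setP/(_ q) : [set p | ~~ safe_path q p] = setT.
  by rewrite !inE /safe_path connect0.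
apply: (minimal_restr gfgA sdA detA) => // [p|p a r].
  case: (boolP (safe_path q p)) => [qp|]; last by exists p; rewrite ?inE.
  have /(safe_pathP _ _ sdA)[u pu] := qp.
  have [p' sp' pp'] := safe_le_run detA detA qs pu.
  exists p' => //; rewrite inE; apply/negP => qp'; apply: nsq.
  have p's : safe_path p' s by apply/normA/safe_pathP => //; exists u.
  by apply: normA; apply: connect_trans qp' p's.
rewrite !inE => nqp pr; exists r => //; rewrite inE; apply: contra nqp => qr.
apply: connect_trans qr _; apply/normA/safe_pathP => //.
by exists [:: a]; rewrite /= pr.
Qed.

(** If they differed, [s] could stand in for [q], and [q] could be deleted. *)
Lemma minimal_safe_eqv_eq A (q s : state A) :
  nice A -> minimal A -> safe_eqv q s -> q = s.
Proof.
move=> [gfgA [_ _ normA sdA detA]] minA qs; apply: contrapT => /eqP nqs.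
have P_eqv (p : state A) : exists2 p', p' \in [set~ q] & safe_eqv p p'.
  case: (eqVneq p q) => [->|npq]; last by exists p; rewrite ?inE.
  by exists s; rewrite // !inE eq_sym.
suff /setP/(_ q) : [set~ q] = setT by rewrite !inE eqxx.
apply: (minimal_restr gfgA sdA detA) => // p.
by have [p' ? []] := P_eqv p; exists p'.
Qed.

(** * Matching the states of two automata *)

Lemma reachable_equiv A B (q : state A) :
  semantically_deterministic A -> semantically_deterministic B ->
  same_lang A B -> reachable q ->
  exists s : state B, same_lang (with_init q) (with_init s).
Proof.
move=> detA detB AB /connectP[p + ->].
have : same_lang (with_init (init A)) (with_init (init B)) by [].
elim: p (init A) (init B) => [|x p IH] y z yz /=; first by exists z.
case/andP=> /existsP[a xy]; have /set0Pn[t tz] := delta_total z a.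
by apply: IH; apply: equiv_step yz xy tz.
Qed.

Lemma nice_dominated A B (q : state A) : nice A -> nice B -> same_lang A B ->
  exists s : state B, safe_le q s.
Proof.
move=> [_ [reachA _ normA sdA detA]] [_ [_ gfgB _ sdB detB]] AB.
have [s0 qs0] := reachable_equiv detA detB AB (reachA q).
exact: safe_le_exists (gfgB s0) qs0.
Qed.

(* Going from A to B and back climbs in the finite preorder [safe_le], so some
   state above q has a partner in B; q shares a safe component with it, hence
   the partner can be carried to q along a safe word. *)
Lemma nice_minimal_partner A B (q : state A) :
  nice A -> nice B -> minimal A -> same_lang A B ->
  exists s : state B, safe_eqv q s.
Proof.
move=> niceA niceB minA AB.
have [[_ [_ _ _ sdA detA]] [_ [_ _ _ _ detB]]] := (niceA, niceB).
have [n] := ubnP #|[set p : state A | `[< safe_le q p >]]|.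
elim: n q => // n IH q; rewrite ltnS => le_n.
have [s qs] := nice_dominated q niceA niceB AB.
have [q' sq'] := nice_dominated s niceB niceA (same_lang_sym AB).
have qq' := safe_le_trans qs sq'.
case: (pselect (safe_le q' q)) => [q'q|nq'q].
  by exists s; split=> //; apply: safe_le_trans sq' q'q.
(* [q] lies above itself but not above [q'], so the set of states above strictly shrinks. *)
have [|s' q's'] := IH q'.
  apply: leq_trans le_n; apply/proper_card/properP; split.
    apply/subsetP => p; rewrite !inE => /asboolP q'p.
    by apply/asboolP; apply: safe_le_trans qq' q'p.
  exists q; rewrite inE; first by apply/asboolP.
  by apply/asboolP.
have /(safe_pathP _ _ sdA)[u uq] := minimal_centralized niceA minA qq'.
by have [t _ qt] := safe_eqv_run detA detB q's' uq; exists t.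
Qed.

(** * Transfer of transitions along the matching *)

Section Transfer.

Variables (A B : tNCW Sigma) (q q' : state A) (s s' : state B) (a : Sigma).
Hypotheses (niceA : nice A) (niceB : nice B) (minB : minimal B).
Hypotheses (qs : safe_eqv q s) (q's' : safe_eqv q' s').

Lemma safe_transfer : q' \in delta_safe q a -> s' \in delta_safe s a.
Proof.
have [[_ [_ _ _ sdA detA]] [_ [_ _ _ sdB detB]]] := (niceA, niceB).
rewrite !sstepP // => /eqP qq'.
have [t -> q't] := safe_eqv_step detA detB qs qq'.
apply/eqP; congr Some; apply: minimal_safe_eqv_eq => //.
exact: safe_eqv_trans (safe_eqv_sym q't) q's'.
Qed.

(** By homogeneity [q] has no safe [a]-move, hence neither has [s]; the move to [s'] is allowed, so
    saturation provides it, and it can only be an alpha-transition. *)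
Lemma alpha_transfer :
  alpha_homogenous A -> alpha_maximal_up_to_homogeneity B ->
  q' \in delta_alpha q a -> s' \in delta_alpha s a.
Proof.
have [[_ [_ _ _ sdA detA]] [_ [_ _ _ sdB detB]]] := (niceA, niceB).
move=> homA [_ maxB] aqq'.
have qa : sstep q a = None.
  by apply/sstep_None; case: (homA q a) aqq' => // ->; rewrite inE.
have sa : sstep s a = None.
  case E: (sstep s a) => [t|] //.
  by have [r] := safe_eqv_step detB detA (safe_eqv_sym qs) E; rewrite qa.
have dqq' : q' \in delta A q a.
  by move: aqq'; rewrite inE => /(subsetP (alpha_sub A)); rewrite inE.
have /set0Pn[t ts] := delta_total s a.
have /sstep_None safe0 := sa.
have : (s, a, s') \in Delta B.
  apply: maxB => //; exists t; split; last by rewrite inE.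
  apply: same_lang_trans (proj1 (proj2 q's')) _.
  exact: (equiv_step detA detB (proj1 (proj1 qs)) dqq' ts).
rewrite [_ \in Delta B]inE /= => ss'; rewrite inE.
by move/setP/(_ s'): safe0; rewrite !inE ss' /= => /negbFE.
Qed.

End Transfer.

End SafeRuns.

Theorem theorem4p5 (Sigma : finType) (A B : tNCW Sigma)
    (niceA : nice A) (niceB : nice B)
    (eqAB : same_lang A B)
    (minA : minimal A) (minB : minimal B)
    (maxA : alpha_maximal_up_to_homogeneity A)
    (maxB : alpha_maximal_up_to_homogeneity B) :
  isomorphic A B.
Proof.
have /fin_all_exists[k kP] (q : state A) :=
  nice_minimal_partner q niceA niceB minA eqAB.
have /fin_all_exists[h hP] (s : state B) :=
  nice_minimal_partner s niceB niceA minB (same_lang_sym eqAB).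
exists k; split.
  (* Both round trips stay inside a [safe_eqv] class, which minimality makes a singleton. *)
  exists h => [q|s]; apply: minimal_safe_eqv_eq => //; apply: safe_eqv_sym.
    exact: safe_eqv_trans (kP q) (hP (k q)).
  exact: safe_eqv_trans (hP s) (kP (h s)).
move=> q q' a; have kP' x := safe_eqv_sym (kP x).
split; split.
- exact: alpha_transfer (kP q) (kP q') maxA.1 maxB.
- exact: alpha_transfer (kP' q) (kP' q') maxB.1 maxA.
- exact: safe_transfer (kP q) (kP q').
- exact: safe_transfer (kP' q) (kP' q').
Qed.
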